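(* Let $\mathcal A$ be a finite alphabet with $|\mathcal A|\ge 2$ and let $C\in\mathbb N$ with $C\ge\log_2(|\mathcal A|+1)-1$. Then a $C$-complete Zorich path $\widetilde\Theta_1,\dots,\widetilde\Theta_N$ on irreducible pairs over $\mathcal A$ has its initial pair uniquely determined up to inverses: if irreducible pairs $(p_0,p_1)$ and $(q_0,q_1)$ over $\mathcal A$ are both initial pairs of the Zorich path $\widetilde\Theta_1,\dots,\widetilde\Theta_N$, then $(q_0,q_1)=(p_0,p_1)$ or $(q_0,q_1)=(p_1,p_0)$.
   Context: A pair over a finite alphabet $\mathcal A$ with $n=|\mathcal A|\ge2$ is a tuple $(p_0,p_1)$ of bijections $p_t:\mathcal A\to\{1,\dots,n\}$. It is irreducible if $p_0^{-1}(\{1,\dots,k\})\ne p_1^{-1}(\{1,\dots,k\})$ for all $1\le k\le n-1$. The inverse of $(p_0,p_1)$ is $(p_1,p_0)$. Rauzy induction of type $t\in\{0,1\}$ on an irreducible pair $(p_0,p_1)$: the winner is $w=p_t^{-1}(n)$ and the loser is $\ell=p_{1-t}^{-1}(n)$. The resulting pair $(p_0',p_1')$ has $p_t'=p_t$ and $p'_{1-t}(b)=p_{1-t}(b)$ if $p_{1-t}(b)\le p_{1-t}(w)$; $p'_{1-t}(b)=p_{1-t}(b)+1$ if $p_{1-t}(w)<p_{1-t}(b)\le n-1$; $p'_{1-t}(\ell)=p_{1-t}(w)+1$. The associated $\mathcal A\times\mathcal A$ matrix $\Theta$ has $\Theta(a,a)=1$ for all $a$, $\Theta(w,\ell)=1$,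 and all other entries $0$. A Rauzy path is a sequence of such moves, each applied to the pair resulting from the previous one, beginning at an initial pair. A finite Rauzy path is complete if each letter of $\mathcal A$ is the winner of at least one move. It is $C$-complete if it is a concatenation of $C$ complete Rauzy paths. A finite sequence of $\mathcal A\times\mathcal A$ matrices $\widetilde\Theta_1,\dots,\widetilde\Theta_N$ is a Zorich path if there is an underlying Rauzy path, with matrices $\Theta_1,\dots,\Theta_{N'}$, and integers $1=m_1<m_2<\dots<m_{N+1}=N'+1$ such that for each $i\in\{1,\dots,N\}$ the Rauzy moves numbered $m_i,\dots,m_{i+1}-1$ all have the same type and $\widetilde\Theta_i=\Theta_{m_i}\Theta_{m_i+1}\cdots\Theta_{m_{i+1}-1}$. (Consecutive $\widetilde\Theta_i$ may have the same type.) An irreducible pair is an initial pair of the Zorich path if some underlying Rauzy path starts at it. A Zorich path is $C$-complete if it has an underlying $C$-complete Rauzy path. *)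

(* Defs.v *)
From HB Require Import structures.
From mathcomp Require Import all_boot all_order all_algebra.
From mathcomp Require Import reals exp.

Set Implicit Arguments.
Unset Strict Implicit.
Unset Printing Implicit Defensive.

Import Order.TTheory GRing.Theory Num.Theory.
Local Open Scope ring_scope.

Definition log2 (R : realType) (x : R) : R := ln x / ln 2.

Section Rauzy.
Variable A : finType.

Local Open Scope nat_scope.

(* [f] is a bijection from [A] onto {1, ..., #|A|}; positions are 1-based. *)
Definition position_bij (f : {ffun A -> nat}) : Prop :=
  injective f /\ forall k : nat, 1 <= k <= #|A| <-> exists a : A, f a = k.

(* The raw data (p_0, p_1); bijectivity is [is_pair] below. *)
Definition pos_pair : Type := ({ffun A -> nat} * {ffun A -> nat})%type.

(* p_t, where the type t = 0 is [false] and t = 1 is [true]; 1 - t is [~~ t]. *)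
Definition pos (p : pos_pair) (t : bool) : {ffun A -> nat} :=
  if t then p.2 else p.1.

Definition is_pair (p : pos_pair) : Prop := forall t : bool, position_bij (pos p t).

Definition inverse_pair (p : pos_pair) : pos_pair := (p.2, p.1).

Definition irreducible (p : pos_pair) : Prop :=
  is_pair p /\
  forall k : nat, 1 <= k <= #|A| - 1 ->
    [set a | 1 <= pos p false a <= k] != [set a | 1 <= pos p true a <= k].

Record rauzy_move : Type :=
  RauzyMove { move_type : bool; winner : A; loser : A }.

(* The last branch of the conditional is reached only by the loser, whose
   position in p_{1-t} is #|A|. *)
Definition rauzy_step (p : pos_pair) (m : rauzy_move) (p' : pos_pair) : Prop :=
  let t := move_type m in
  let w := winner m in
  let l := loser m in
  [/\ pos p t w = #|A|,
      pos p (~~ t) l = #|A|,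
      pos p' t = pos p t
    & forall b : A,
        pos p' (~~ t) b =
          if pos p (~~ t) b <= pos p (~~ t) w then pos p (~~ t) b
          else if pos p (~~ t) b <= #|A| - 1 then pos p (~~ t) b + 1
          else pos p (~~ t) w + 1].

(* [s] is the list of moves of a Rauzy path starting at [p].  Irreducibility is
   only required of the initial pair: Rauzy induction preserves it. *)
Fixpoint moves_from (p : pos_pair) (s : seq rauzy_move) : Prop :=
  if s is m :: s' then exists2 p', rauzy_step p m p' & moves_from p' s'
  else True.

Definition rauzy_path (p : pos_pair) (s : seq rauzy_move) : Prop :=
  irreducible p /\ moves_from p s.

Definition complete (s : seq rauzy_move) : bool :=
  [forall a : A, a \in map winner s].

Definition C_complete (C : nat) (s : seq rauzy_move) : Prop :=
  exists ss : seq (seq rauzy_move),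
    [/\ size ss = C, all complete ss & s = flatten ss].

Local Open Scope ring_scope.

(* A x A matrices are 'M_#|A|, the row and column of the letter [a] being
   [enum_rank a]. *)
Definition theta (m : rauzy_move) : 'M[int]_#|A| :=
  \matrix_(i, j)
    ((i == j) ||
     ((i == enum_rank (winner m)) && (j == enum_rank (loser m))))%:R.

Definition same_type (b : seq rauzy_move) : bool :=
  [exists t : bool, all (fun m => move_type m == t) b].

(* The blocks [bs] are the consecutive segments of moves numbered
   m_i, ..., m_{i+1} - 1; they are nonempty since m_i < m_{i+1}. *)
Definition underlies (s : seq rauzy_move) (Ts : seq 'M[int]_#|A|) : Prop :=
  exists bs : seq (seq rauzy_move),
    [/\ s = flatten bs,
        all (fun b => (0 < size b)%N && same_type b) bs
      & Ts = [seq \prod_(m <- b) theta m | b <- bs]].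

Definition underlying_path (Ts : seq 'M[int]_#|A|) (p : pos_pair)
    (s : seq rauzy_move) : Prop :=
  rauzy_path p s /\ underlies s Ts.

Definition zorich_path (Ts : seq 'M[int]_#|A|) : Prop :=
  exists p, exists s, underlying_path Ts p s.

Definition initial_pair (Ts : seq 'M[int]_#|A|) (p : pos_pair) : Prop :=
  exists s, underlying_path Ts p s.

Definition C_complete_zorich (C : nat) (Ts : seq 'M[int]_#|A|) : Prop :=
  exists p, exists s, underlying_path Ts p s /\ C_complete C s.

End Rauzy.

(* Main.v *)
Require Import Defs.
From HB Require Import structures.
From mathcomp Require Import all_boot all_order all_algebra zify.
From mathcomp Require Import reals exp.

(** Why the initial pair is determined.

    The matrix of a block is [1] plus a single nonzero row: it gives the winner
    of the block and the number of times each letter loses in it, but not the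
    order of the losses ([theta_prod_losses]).  Two consecutive winners are
    equal exactly when the type does not change, so the winners give all types
    up to a global exchange; inverting one of the pairs, the types of the two
    paths agree ([follows_type]).

    Now read both paths backwards and compare the rows [f = p_t] and [g = q_t].
    A threshold [h] is agreed when the same letters occupy the positions [<= h]
    in [f] and in [g]; a letter is known when it has the same position in both
    and this position is agreed.  A block with winner [w] rotates the part of
    one row that lies to the right of [w].  Undoing it ([rotation_gain])
    loses no agreed threshold and no known letter, and it creates a new agreed
    threshold whenever [w] is not known in the rotated row: the losers, put back
    at the end of the row, are then separated from the other letters.

    Consider a complete path and a letter [x] that is unknown in row [t] at its
    beginning, hence all along.  When [x] wins, it cannot be with type [t],
    since it would be last in row [t] of both pairs, and so known.  So [x] wins
    in a block that rotates row [t], and this block gains a threshold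
    ([path_gain]).  If [D > 0] thresholds are not agreed at the beginning, then
    more than [D] letters are unknown ([deficit_lt_unknown]), and therefore at
    least [2 D + 1] thresholds were not agreed at the end.  Over [C] complete
    paths, [D + 1] grows by the factor [2 ^ C] and would exceed [#|A|]
    ([complete_gain]); so [D = 0] and the two rows coincide.

    A complete path may end inside a block.  If the winner of this block has
    not won before in that path, the preceding block has the other type and
    its winner is the first loser of the block, for both pairs.  The first move
    can thus be split off, the losses of both halves being still known: it
    stays in the first path, and the other moves go to the next one
    ([split_group]). *)

Set Implicit Arguments.
Unset Strict Implicit.
Unset Printing Implicit Defensive.

Import Order.TTheory GRing.Theory Num.Theory.
Local Open Scope ring_scope.

(** * Comparing two rows *)

Section Rows.
Local Open Scope nat_scope.
Variable A : finType.
Implicit Types (f g : {ffun A -> nat}) (a b x : A) (h k c : nat).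

Definition agree f g h := [forall a, (f a <= h) == (g a <= h)].

Definition known f g x := (f x == g x) && agree f g (f x).

(** The number of thresholds that are not agreed.  A threshold is represented by the
    letter on it in [f], because undoing a rotation carries an agreed threshold
    along with its letter (see [same_pivot_agree]). *)
Definition deficit f g := #|[set a | ~~ agree f g (f a)]|.

Lemma agreeP f g h :
  reflect (forall a, (f a <= h) = (g a <= h)) (agree f g h).
Proof. by apply: (iffP forallP) => H a; [exact: (eqP (H a)) | rewrite H eqxx]. Qed.

Lemma agree_sym f g h : agree f g h = agree g f h.
Proof. by apply/agreeP/agreeP => H a; rewrite H. Qed.

Lemma known_sym f g x : known f g x = known g f x.
Proof. by rewrite /known eq_sym agree_sym; case: eqP => // ->. Qed.

Lemma position_range f a : position_bij f -> 0 < f a <= #|A|.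
Proof. by case=> _ H; apply/H; exists a. Qed.

Lemma position_surj f h : position_bij f -> 0 < h <= #|A| -> exists a, f a = h.
Proof. by case=> _ H /H. Qed.

Lemma card_positions f h h' :
  position_bij f -> h <= h' <= #|A| -> #|[set a | h < f a <= h']| = h' - h.
Proof.
move=> pf /andP[hh' h'n].
have /fin_all_exists [j fj] : forall i : 'I_(h' - h), exists a, f a = (h + i).+1.
  by move=> i; apply: position_surj => //; have := ltn_ord i; lia.
rewrite -[RHS]card_ord -cardsT -(card_imset (f := j)); last first.
  by move=> i i' /(congr1 f); rewrite !fj => e; apply: ord_inj; lia.
apply: eq_card => a; rewrite inE; apply/idP/imsetP => [ha | [i _ ->]].
  have lt : f a - h.+1 < h' - h by lia.
  by exists (Ordinal lt) => //; apply: pf.1; rewrite fj /=; lia.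
by rewrite fj; have := ltn_ord i; lia.
Qed.

Lemma agree_full f g : position_bij f -> position_bij g -> agree f g #|A|.
Proof.
move=> pf pg; apply/agreeP => a.
by have := position_range a pf; have := position_range a pg; lia.
Qed.

Lemma agree_pred f g x :
  position_bij f -> position_bij g -> known f g x -> agree f g (f x).-1.
Proof.
move=> pf pg /andP[/eqP fg /agreeP ag]; apply/agreeP => a.
have := ag a; have := position_range x pf; have := position_range a pf.
have [->|ax] := eqVneq a x; first by lia.
have : f a != f x by apply: contra_neq ax => /pf.1.
have : g a != g x by apply: contra_neq ax => /pg.1.
lia.
Qed.

(** [0] is always agreed, and the other thresholds are positions of letters. *)
Lemma deficit0_eq f g :
  position_bij f -> position_bij g -> deficit f g = 0 -> f = g.
Proof.
move=> pf pg /eqP; rewrite cards_eq0 => /eqP/setP D0.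
have ag h : h <= #|A| -> agree f g h.
  case: h => [_|h hn].
    apply/agreeP => a; have := position_range a pf.
    by have := position_range a pg; lia.
  have [a fa] := @position_surj f h.+1 pf hn.
  by have := D0 a; rewrite !inE fa => /negbFE.
apply/ffunP => a.
have /agreeP/(_ a) := ag _ (proj2 (andP (position_range a pf))).
have /agreeP/(_ a) := ag _ (proj2 (andP (position_range a pg))).
lia.
Qed.

(** The threshold [#|A|] is always agreed. *)
Lemma deficit_lt f g : 0 < #|A| ->
  position_bij f -> position_bij g -> deficit f g < #|A|.
Proof.
move=> n0 pf pg.
have [a fa] : exists a, f a = #|A| by apply: position_surj; rewrite ?n0 /=.
rewrite -[X in _ < X]cardsT; apply: proper_card; rewrite properEneq subsetT.
rewrite andbT; apply/eqP => /setP/(_ a).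
by rewrite !inE fa agree_full.
Qed.

(** A letter on a threshold that is not agreed is unknown.  One unknown letter
    sits on an agreed threshold: the rightmost one, since its right neighbour is
    known or absent ([agree_pred], [agree_full]). *)
Lemma deficit_lt_unknown f g : position_bij f -> position_bij g ->
  0 < deficit f g -> deficit f g < #|[set x | ~~ known f g x]|.
Proof.
move=> pf pg; rewrite card_gt0 => /set0Pn [a0]; rewrite inE => na0.
have Ka0 : ~~ known f g a0 by rewrite negb_and na0 orbT.
have [m Km mmax] := @arg_maxnP A a0 (fun x => ~~ known f g x) f Ka0.
apply: proper_card; apply/properP; split.
  by apply/subsetP => a; rewrite !inE negb_and orbC => ->.
exists m; rewrite !inE ?Km // negbK.
have [mn|mn] := eqVneq (f m) #|A|; first by rewrite mn agree_full.
have rm := position_range m pf.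
have [b fb] : exists b, f b = (f m).+1 by apply: position_surj => //; lia.
have Kb : known f g b.
  by apply/negPn/negP => /mmax; rewrite fb; lia.
by have := agree_pred pf pg Kb; rewrite fb.
Qed.

(** [k] Rauzy moves that rotate the part of a row to the right of position [c].
    Each move shifts a letter by one, and a letter that loses drops by the length
    [#|A| - c] of this part; so [cnt], the number of losses, replaces the
    remainders modulo [#|A| - c]. *)
Record rotates c k (cnt : A -> nat) f f' : Prop := Rotates {
  rotates_low : forall a, f a <= c -> f' a = f a /\ cnt a = 0;
  rotates_high : forall a, c < f a ->
    c < f' a /\ f' a + (#|A| - c) * cnt a = f a + k }.

(** Applied to the loss counts of two letters, this leaves linear arithmetic. *)
Lemma mul_gap d i j :
  d * i = d * j \/ d * i + d <= d * j \/ d * j + d <= d * i.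
Proof.
by case: (ltngtP i j) => [ij|ij|->]; [right; left|right; right|left];
  rewrite // -mulnSr leq_mul2l ij orbT.
Qed.

(** First case: the winner has the same position [c] in both rows. *)
Section SamePivot.
Variables (c k : nat) (cnt : A -> nat) (f f' g g' : {ffun A -> nat}).
Hypotheses (cn : c < #|A|)
  (pf : position_bij f) (pf' : position_bij f')
  (pg : position_bij g) (pg' : position_bij g')
  (rf : rotates c k cnt f f') (rg : rotates c k cnt g g').

(** Suppose that [f b <= f a < g b], all in the rotating part.  If [a] and [b] lose
    equally often, the three positions are shifted alike, and [f' a] still
    separates [f' b] from [g' b].  Otherwise the shifts differ by at least the
    length of the part, and [f' b] or [g' b] would fall outside of it. *)
Lemma same_pivot_agree a : agree f' g' (f' a) -> agree f g (f a).
Proof.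
move=> /agreeP ag; apply/agreeP => b; have := ag b.
have := mul_gap (#|A| - c) (cnt a) (cnt b).
have : cnt b = 0 -> (#|A| - c) * cnt b = 0 by move=> ->; rewrite muln0.
have := position_range a pf; have := position_range a pf'.
have := position_range b pf; have := position_range b pf'.
have := position_range b pg; have := position_range b pg'.
have [ac|ac] := leqP (f a) c; have [bc|bc] := leqP (f b) c;
  have [bc'|bc'] := leqP (g b) c.
all: try have [] := rotates_low rf ac.
all: try have [] := rotates_high rf ac.
all: try have [] := rotates_low rf bc.
all: try have [] := rotates_high rf bc.
all: try have [] := rotates_low rg bc'.
all: try have [] := rotates_high rg bc'.
all: move: (_ * cnt a) (_ * cnt b) => P Q; lia.
Qed.

Lemma same_pivot_known x : known f' g' x -> known f g x.
Proof.
move=> /andP[/eqP e ag]; apply/andP; split; last exact: same_pivot_agree.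
have [bc|bc] := leqP (f x) c; have [bc'|bc'] := leqP (g x) c.
all: try have [] := rotates_low rf bc.
all: try have [] := rotates_high rf bc.
all: try have [] := rotates_low rg bc'.
all: try have [] := rotates_high rg bc'.
all: lia.
Qed.

(** The last letter of [f] goes to position [c + k]; if this is agreed in the
    rotated rows, so is [c]. *)
Lemma same_pivot_gain a :
  0 < k -> f a = #|A| -> ~~ agree f' g' c -> ~~ agree f' g' (f' a).
Proof.
move=> k0 fa; apply: contra => /agreeP ag; apply/agreeP => b.
have := ag b.
have := mul_gap (#|A| - c) (cnt a) 1; rewrite muln1.
have : cnt b = 0 -> (#|A| - c) * cnt b = 0 by move=> ->; rewrite muln0.
have ac : c < f a by rewrite fa.
have [ac1] := rotates_high rf ac; rewrite fa.
have := position_range a pf'.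
have := position_range b pf; have := position_range b pf'.
have := position_range b pg; have := position_range b pg'.
have [bc|bc] := leqP (f b) c;  have [bc'|bc'] := leqP (g b) c.
all: try have [] := rotates_low rf bc.
all: try have [] := rotates_high rf bc.
all: try have [] := rotates_low rg bc'.
all: try have [] := rotates_high rg bc'.
all: move: (_ * cnt a) (_ * cnt b) => P Q; lia.
Qed.
End SamePivot.

(** Within one turn the losers are the last [k] letters, and each loses once. *)
Lemma rotates_short c k cnt f f' a :
    position_bij f -> position_bij f' -> rotates c k cnt f f' ->
    c < #|A| -> k <= #|A| - c -> c < f a ->
  if #|A| - k < f a then cnt a = 1 /\ f' a + #|A| = f a + k + c
  else cnt a = 0 /\ f' a = f a + k.
Proof.
move=> pf pf' rf cn kd ac; have [] := rotates_high rf ac.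
have := position_range a pf'; have := position_range a pf.
case: (cnt a) => [|[|e]]; rewrite ?muln0 ?muln1; try by case: ifP; lia.
have : (#|A| - c) * 2 <= (#|A| - c) * e.+2 by rewrite leq_mul2l orbT.
by move: (_ * e.+2) => P; case: ifP; lia.
Qed.

(** Second case: the winner [w] is further to the left in [f] than in [g]. *)
Section DifferentPivots.
Variables (c c' k : nat) (cnt : A -> nat) (f f' g g' : {ffun A -> nat}).
Hypotheses (w : A) (fw : f w = c) (gw : g w = c')
  (cc' : c < c') (cn : c' < #|A|) (k0 : 0 < k)
  (pf : position_bij f) (pf' : position_bij f')
  (pg : position_bij g) (pg' : position_bij g')
  (rf : rotates c k cnt f f') (rg : rotates c' k cnt g g').

Let cnt_eq0 b : cnt b = 0 -> (#|A| - c) * cnt b = 0 /\ (#|A| - c') * cnt b = 0.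
Proof. by move=> ->; rewrite !muln0. Qed.

Let not_below : ~ (forall a, c < f a -> c' < g a).
Proof.
move=> H.
have : #|[set a | c < f a <= #|A| ]| <= #|[set a | c' < g a <= #|A| ]|.
  apply: subset_leq_card; apply/subsetP => a; rewrite !inE => /andP[/H -> _].
  by case/andP: (position_range a pg).
by rewrite !card_positions //; lia.
Qed.

(** More than one turn of the shorter part would make all its letters lose, and its
    last letter lose twice.  The latter takes a full turn of the longer part as
    well; but then all letters of the longer part lose, hence lie in the shorter. *)
Lemma different_pivots_turn : k <= #|A| - c'.
Proof.
rewrite leqNgt; apply/negP => kd.
have lose_g a : c' < g a -> 0 < cnt a.
  move=> ac; rewrite lt0n; apply/eqP => /cnt_eq0.
  have [] := rotates_high rg ac; have := position_range a pg'; lia.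
have [kd'|kd'] := leqP (#|A| - c) k.
  apply: not_below => a ac; rewrite ltnNge; apply/negP => ac'.
  have [_ /cnt_eq0] := rotates_low rg ac'.
  have [] := rotates_high rf ac; have := position_range a pf'; lia.
have [a ga] : exists a, g a = #|A| by apply: position_surj => //; lia.
have ac' : c' < g a by lia.
have := lose_g a ac'; have [ac|ac] := leqP (f a) c.
  by have [_ ->] := rotates_low rf ac.
have := rotates_short pf pf' rf (ltn_trans cc' cn) (ltnW kd') ac.
have := position_range a pg'; have [] := rotates_high rg ac'; rewrite ga.
case: ifP => _ _ ga' ran [ca _] c0; move: ga'; rewrite ca in c0 *; lia.
Qed.

Let kd := different_pivots_turn.
Let kd' : k <= #|A| - c. Proof. by have := kd; lia. Qed.
Let cn' : c < #|A|. Proof. by lia. Qed.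

Let shift_f a :
  [/\ f a <= c, f' a = f a & cnt a = 0] \/
  [/\ c < f a, f a <= #|A| - k, cnt a = 0 & f' a = f a + k] \/
  [/\ c < f a, #|A| - k < f a, cnt a = 1 & f' a + #|A| = f a + k + c].
Proof.
have [ac|ac] := leqP (f a) c; first by left; case: (rotates_low rf ac).
right; have := rotates_short pf pf' rf cn' kd' ac.
by case: ltnP => an [? ?]; [right|left].
Qed.
Let shift_g a :
  [/\ g a <= c', g' a = g a & cnt a = 0] \/
  [/\ c' < g a, g a <= #|A| - k, cnt a = 0 & g' a = g a + k] \/
  [/\ c' < g a, #|A| - k < g a, cnt a = 1 & g' a + #|A| = g a + k + c'].
Proof.
have [ac|ac] := leqP (g a) c'; first by left; case: (rotates_low rg ac).
right; have := rotates_short pg pg' rg cn kd ac.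
by case: ltnP => an [? ?]; [right|left].
Qed.

(** Thresholds between the two positions of [w] are excluded by [w] itself.  Above
    them, and below [c' + k], the losers, which follow [w] in the rows after the
    block, would fill different numbers of positions beyond [h]. *)
Lemma different_pivots_agree h : agree f' g' h -> (h < c) || (c' + k <= h).
Proof.
move=> /agreeP ag; apply/negPn/negP; rewrite negb_or -leqNgt -ltnNge => /andP[ch hc].
have ch' : c' <= h.
  have [fw' _] : f' w = f w /\ cnt w = 0 by apply: (rotates_low rf); rewrite fw.
  have [gw' _] : g' w = g w /\ cnt w = 0 by apply: (rotates_low rg); rewrite gw.
  have := ag w; lia.
have : #|[set a | h < g' a <= c' + k]| <= #|[set a | h < f' a <= maxn h (c + k)]|.
  apply: subset_leq_card; apply/subsetP => a; rewrite !inE.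
  have := ag a; have := position_range a pf; have := position_range a pg.
  by case: (shift_f a) => [[]|[[]|[]]]; case: (shift_g a) => [[]|[[]|[]]]; lia.
rewrite !card_positions //; have := kd; lia.
Qed.

(** Thresholds left of [w] stay, and those right of the moved letters follow
    their shift by [k]. *)
Lemma different_pivots_shift h :
  h <= #|A| -> agree f' g' h ->
  if h < c then agree f g h else agree f g (h - k).
Proof.
move=> hn ag; have := different_pivots_agree ag.
move: ag => /agreeP ag; have kd1 := kd.
case: (ltnP h c) => hc /= hc'; apply/agreeP => a;
have := ag a; have := position_range a pf; have := position_range a pg;
have := position_range a pf'; have := position_range a pg';
case: (shift_f a) => [[]|[[]|[]]]; case: (shift_g a) => [[]|[[]|[]]]; lia.
Qed.

Lemma different_pivots_agree_low a : agree f' g' (f' a) -> agree f g (f a).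
Proof.
move=> ag; have := different_pivots_agree ag; have hn := position_range a pf'.
have := different_pivots_shift (proj2 (andP hn)) ag.
have := position_range a pf; have kd1 := kd.
case: (shift_f a) => [[? -> _]|[[? ? _ ->]|[]]];
  case: (ltnP _ c); rewrite ?addnK //; lia.
Qed.

Lemma different_pivots_agree_high a : agree f' g' (g' a) -> agree f g (g a).
Proof.
move=> ag; have := different_pivots_agree ag; have hn := position_range a pg'.
have := different_pivots_shift (proj2 (andP hn)) ag.
have := position_range a pg; have kd1 := kd.
have [-> _ _ _|ga] := eqVneq (g a) #|A|; first exact: agree_full.
case: (shift_g a) => [[? -> _]|[[? ? _ ->]|[]]];
  case: (ltnP _ c); rewrite ?addnK //; lia.
Qed.

Lemma different_pivots_known x : known f' g' x -> known f g x.
Proof.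
move=> /andP[/eqP e ag]; apply/andP; split; last exact: different_pivots_agree_low.
have := different_pivots_agree ag; have := position_range x pf.
have := position_range x pg; have kd1 := kd.
case: (shift_f x) => [[]|[[]|[]]]; case: (shift_g x) => [[]|[[]|[]]]; lia.
Qed.

Lemma different_pivots_gain_low a : f a = #|A| -> ~~ agree f' g' (f' a).
Proof.
move=> fa; apply/negP => /different_pivots_agree.
case: (shift_f a) => [[]|[[]|[]]]; lia.
Qed.

(** The new threshold for [g].  It is the last letter, unless its image [c' + k]
    is agreed in the rotated rows; but then [c'], the position of [w], becomes
    agreed, and it was not. *)
Lemma different_pivots_gain_high :
  exists a, agree f g (g a) && ~~ agree f' g' (g' a).
Proof.
have kd1 := kd.
have [gw' _] : g' w = g w /\ cnt w = 0 by apply: (rotates_low rg); rewrite gw.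
have [ag|nag] := boolP (agree f' g' (c' + k)).
  have ck : c' + k <= #|A| by lia.
  exists w; rewrite gw' gw; apply/andP; split.
    by have := different_pivots_shift ck ag; case: ltnP; rewrite ?addnK //; lia.
  by apply/negP => /different_pivots_agree; lia.
have [a ga] : exists a, g a = #|A| by apply: position_surj => //; lia.
exists a; rewrite ga agree_full //=; suff -> : g' a = c' + k by [].
case: (shift_g a) => [[]|[[]|[]]]; lia.
Qed.
End DifferentPivots.

Lemma deficit_drop f f' g g' (lost : bool) :
    (forall a, agree f' g' (f' a) -> agree f g (f a)) ->
    (lost -> exists a, agree f g (f a) && ~~ agree f' g' (f' a)) ->
  deficit f g + lost <= deficit f' g'.
Proof.
move=> H G; rewrite /deficit.
have sub : [set a | ~~ agree f g (f a)] \subset [set a | ~~ agree f' g' (f' a)].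
  by apply/subsetP => a; rewrite !inE; apply: contra => /H.
case: lost G => [/(_ isT) [a /andP[ag nag]]|_]; last by rewrite addn0 subset_leq_card.
rewrite addn1; apply: proper_card; apply/properP; split => //.
by exists a; rewrite !inE ?nag ?negbK.
Qed.

(** The gain when a rotation is undone: [f'] and [g'] are the rows after the
    block, [f] and [g] those before it. *)
Lemma rotation_gain w k cnt f f' g g' :
    0 < k -> f w < #|A| -> g w < #|A| ->
    position_bij f -> position_bij f' -> position_bij g -> position_bij g' ->
    rotates (f w) k cnt f f' -> rotates (g w) k cnt g g' ->
  (forall x, known f' g' x -> known f g x) /\
  deficit f g + ~~ known f' g' w <= deficit f' g'.
Proof.
move=> k0 fn gn pf pf' pg pg' rf rg.
have [a fa] : exists a, f a = #|A| by apply: position_surj => //; lia.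
have [e|fg|gf] := ltngtP (f w) (g w); last first.
- rewrite -gf in rg; split.
    by move=> x; exact: (same_pivot_known fn pf pf' pg pg' rf rg).
  apply: deficit_drop => [b|nk]; first exact: (same_pivot_agree fn pf pf' pg pg' rf rg).
  exists a; rewrite fa agree_full //=; apply: (same_pivot_gain fn pf pf' pg pg' rf rg k0 fa).
  move: nk; rewrite /known; have [-> _] := rotates_low rf (leqnn (f w)).
  by have [-> _] := rotates_low rg (eq_leq (esym gf)); rewrite gf eqxx.
- split; first by move=> x; rewrite (known_sym f' g') (known_sym f g);
    apply: (different_pivots_known (erefl _) (erefl _) fg fn k0 pg pg' pf pf' rg rf) => //.
  apply: deficit_drop => [b|_].
    rewrite (agree_sym f' g') (agree_sym f g).
    by apply: (different_pivots_agree_high (erefl _) (erefl _) fg fn k0 pg pg' pf pf' rg rf).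
  have [b] := different_pivots_gain_high (erefl _) (erefl _) fg fn k0 pg pg' pf pf' rg rf.
  by exists b; rewrite (agree_sym f' g') (agree_sym f g).
split.
  move=> x.
  by apply: (different_pivots_known (erefl _) (erefl _) e gn k0 pf pf' pg pg' rf rg).
apply: deficit_drop => [b|_].
  by apply: (different_pivots_agree_low (erefl _) (erefl _) e gn k0 pf pf' pg pg' rf rg).
exists a; rewrite fa agree_full //=.
by apply: (different_pivots_gain_low (erefl _) (erefl _) e gn k0 pf pf' pg pg' rf rg fa).
Qed.
End Rows.

(** * Rauzy moves *)

Section Moves.
Local Open Scope nat_scope.
Variable A : finType.
Hypothesis cardA : 1 < #|A|.
Implicit Types (p q : pos_pair A) (m : rauzy_move A) (s : seq (rauzy_move A)).
Implicit Types (t : bool) (w : A).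

Lemma irreducible_neq p t k : irreducible p -> 1 <= k <= #|A| - 1 ->
  [set a | 1 <= pos p t a <= k] != [set a | 1 <= pos p (~~ t) a <= k].
Proof. by case: t => -[_ H] /H //=; rewrite eq_sym. Qed.

Lemma irreducible_last p t a : irreducible p ->
  pos p t a = #|A| -> pos p (~~ t) a != #|A|.
Proof.
move=> ip pa; apply/eqP => pa'.
have kr : 1 <= #|A| - 1 <= #|A| - 1 by lia.
move: (irreducible_neq t ip kr) => /eqP; apply; apply/setP => b; rewrite !inE.
have [->|ba] := eqVneq b a; first by lia.
have b1 : pos p t b != #|A| by rewrite -pa; apply: contra_neq ba => /(ip.1 t).1.
have b2 : pos p (~~ t) b != #|A|.
  by rewrite -pa'; apply: contra_neq ba => /(ip.1 (~~ t)).1.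
have := position_range b (ip.1 t); have := position_range b (ip.1 (~~ t)); lia.
Qed.

Lemma winner_neq_loser p m p' :
  irreducible p -> rauzy_step p m p' -> winner m != loser m.
Proof.
move=> ip [pw pl _ _]; apply/eqP => e.
by have /eqP := irreducible_last ip pw; rewrite e.
Qed.

Lemma position_bij_insert (f f' : {ffun A -> nat}) w l :
    position_bij f -> f l = #|A| -> f w != #|A| ->
    (forall b, f' b = if f b <= f w then f b
                      else if f b <= #|A| - 1 then f b + 1 else f w + 1) ->
  position_bij f'.
Proof.
move=> bf fl fw ff'; have rw := position_range w bf.
split=> [a b|k].
  rewrite !ff' => e; apply: bf.1.
  have := position_range a bf; have := position_range b bf; move: e.
  by do 4?[case: ifP]; lia.
split=> [kn|[a <-]]; last first.
  by rewrite ff'; have := position_range a bf; do 2?[case: ifP]; lia.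
have [kw|kw] := leqP k (f w).
  have [|a fa] := @position_surj _ f k bf; first by lia.
  by exists a; rewrite ff' fa kw.
have [kw'|kw'] := eqVneq k (f w).+1.
  by exists l; rewrite ff' fl; do 2?[case: ifP]; lia.
have [|a fa] := @position_surj _ f k.-1 bf; first by lia.
by exists a; rewrite ff' fa; do 2?[case: ifP]; lia.
Qed.

(** In the changed row, initial segments that stop before [w] are unchanged, and
    the longer ones contain [w], which is last in the other row. *)
Lemma irreducible_step p m p' :
  irreducible p -> rauzy_step p m p' -> irreducible p'.
Proof.
move=> ip st; have wl := winner_neq_loser ip st.
case: st; case: m wl => t w l /= wl pw pl pt pu.
have wn := irreducible_last ip pw.
set u := ~~ t in pl pu wn; have bu := ip.1 u.
have rw := position_range w bu.
have bu' : position_bij (pos p' u) by apply: position_bij_insert bu pl wn pu.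
have irk k := @irreducible_neq p t k ip.
have eu : u = ~~ t by [].
rewrite -/u in irk; clearbody u.
have neq : forall k, 1 <= k <= #|A| - 1 ->
    [set a | 1 <= pos p' t a <= k] != [set a | 1 <= pos p' u a <= k].
  move=> k kn; have [kw|kw] := leqP k (pos p u w).
    rewrite pt; move: (irk _ kn); apply: contra_neq => ->.
    apply/setP => a; rewrite !inE pu; have := position_range a bu.
    by do 2?[case: ifP]; lia.
  apply/eqP => /setP/(_ w); rewrite !inE pu pt pw leqnn (ltnW kw).
  by rewrite (proj1 (andP rw)) => /andP[_]; set n := #|A| in kn *; lia.
split; first by have bt := ip.1 t; rewrite -pt in bt;
  rewrite eu in bu'; move: bu' bt; clear; case: t => bu' bt [].
by rewrite eu in neq; case: (t) neq => //= H k /H; rewrite eq_sym.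
Qed.

(** [moves_from] with its final pair made explicit, so that paths can be cut. *)
Fixpoint run p s p' : Prop :=
  if s is m :: s' then exists2 p1, rauzy_step p m p1 & run p1 s' p'
  else p' = p.

Lemma run_cat p s1 s2 p' : run p (s1 ++ s2) p' ->
  exists2 p1, run p s1 p1 & run p1 s2 p'.
Proof.
elim: s1 p => [|m s1 IH] p /=; first by exists p.
by case=> p1 st /IH[p2 r1 r2]; exists p2 => //; exists p1.
Qed.

Lemma moves_run p s : moves_from p s -> exists p', run p s p'.
Proof.
elim: s p => [|m s IH] p /=; first by exists p.
by case=> p1 st /IH[p2 r]; exists p2, p1.
Qed.

Lemma irreducible_run p s p' : irreducible p -> run p s p' -> irreducible p'.
Proof.
elim: s p => [|m s IH] p ip /=; first by move=> ->.
by case=> p1 /(irreducible_step ip); apply: IH.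
Qed.

Definition uniform t w s := all (fun m => (move_type m == t) && (winner m == w)) s.

(** The loser, at position [#|A|], is reinserted right of [w], and every letter
    between shifts by one: each move turns this part of the row by one step. *)
Lemma run_uniform t w s p p' : irreducible p -> run p s p' -> uniform t w s ->
  pos p' t = pos p t /\
  rotates (pos p (~~ t) w) (size s) (fun b => count_mem b (map (@loser A) s))
    (pos p (~~ t)) (pos p' (~~ t)).
Proof.
elim: s p => [|m s IH] p ip /=.
  by move=> -> _; split=> //; split=> a; rewrite ?muln0 ?addn0.
case=> p1 st r /andP[/andP[/eqP mt /eqP mw] us].
have ip1 := irreducible_step ip st.
have [-> [lo hi]] := IH p1 ip1 r us.
case: st; rewrite mt mw => pw pl pt pu; rewrite pt; split=> //.
have wn := position_range w (ip.1 (~~ t)).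
have := irreducible_last ip pw; move=> wn'.
have puw : pos p1 (~~ t) w = pos p (~~ t) w by rewrite pu leqnn.
rewrite puw in lo hi.
split=> a aw; have := position_range a (ip.1 (~~ t)) => ra.
  have p1a : pos p1 (~~ t) a = pos p (~~ t) a by rewrite pu aw.
  have := lo a; rewrite p1a => -[] // -> ->.
  split=> //; rewrite addn0; case: eqP => // e; rewrite e in pl; lia.
have := pu a; rewrite leqNgt aw /=; have := hi a.
have [<-|la] := eqVneq (loser m) a.
  have nA := cardA; rewrite pl; set n := #|A| in nA *; case: ifP; first by lia.
  move=> _ H pa; case: H; first by rewrite pa; lia.
  move=> H1 H2; split=> //; rewrite /= mulnDr muln1.
  by move: H2; rewrite pa; move: (_ * count _ _) => P; lia.
have : pos p (~~ t) a != #|A| by rewrite -pl; apply: contra_neq la => /(ip.1 _).1.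
move=> an H; set n := #|A| in ra an H *; case: ifP; last by lia.
move=> _ pa; case: H => [|H1 H2]; first by rewrite pa; lia.
by split=> //; rewrite add0n; move: H2; rewrite pa; move: (_ * _) => P; lia.
Qed.

(** The trace that the last letters of the two rows leave on consecutive moves:
    after a move of type [t], the last letter of row [t] is still its winner. *)
Definition follows m m' :=
  if move_type m' == move_type m then winner m' == winner m
  else (loser m' == winner m) && (winner m' != winner m).

Lemma run_sorted p s p' : irreducible p -> run p s p' -> sorted follows s.
Proof.
case: s => [|m s] //= ip [p1 st r].
elim: s m p ip p1 st r => [|m' s IH] //= m p ip p1 st [p2 st' r].
have ip1 := irreducible_step ip st; rewrite (IH _ _ ip1 _ st' r) andbT.
have wl' := winner_neq_loser ip1 st'.
case: st st' => pw pl pt pu [pw' pl' _ _]; rewrite /follows; case: eqP => e.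
  by apply/eqP; apply: (ip.1 (move_type m)).1; rewrite -pt -{1}e pw' pt pw.
have {e} e : ~~ move_type m' = move_type m.
  by move: e; case: (move_type m); case: (move_type m').
have lw : loser m' = winner m.
  by apply: (ip.1 (move_type m)).1; rewrite -pt -{1}e pl' pt pw.
by rewrite lw eqxx -lw.
Qed.
End Moves.

(** * Gain along a path *)

Section Gain.
Local Open Scope nat_scope.
Variable A : finType.
Hypothesis cardA : 1 < #|A|.
Implicit Types (p q : pos_pair A) (m : rauzy_move A) (s : seq (rauzy_move A)).
Implicit Types (t : bool) (w : A).

(** A block of the path from [p] with the corresponding block of the path from
    [q]: all that is kept is the type, the winner and the multiset of losers. *)
Definition matched (o : seq (rauzy_move A) * seq (rauzy_move A)) :=
  [exists t, exists w, [&& 0 < size o.1, uniform t w o.1, uniform t w o.2 &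
    perm_eq (map (@loser A) o.1) (map (@loser A) o.2)]].

Lemma matchedP o : reflect
  (exists t w, [/\ 0 < size o.1, uniform t w o.1, uniform t w o.2 &
    perm_eq (map (@loser A) o.1) (map (@loser A) o.2)]) (matched o).
Proof.
apply: (iffP existsP) => [[t /existsP [w /and4P H]]|[t [w /and4P H]]].
  by exists t, w.
by exists t; apply/existsP; exists w.
Qed.

Lemma run_type_row t w s p p' :
  0 < size s -> uniform t w s -> run p s p' -> pos p t w = #|A|.
Proof. by case: s => //= m s _ /andP[/andP[/eqP<- /eqP<-] _] [p1 []]. Qed.

(** In row [t] nothing moves and [w] is last in both pairs, hence known; in the
    other row this is [rotation_gain]. *)
Lemma block_gain o t w p q p' q' :
    irreducible p -> irreducible q -> run p o.1 p' -> run q o.2 q' ->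
    0 < size o.1 -> uniform t w o.1 -> uniform t w o.2 ->
    perm_eq (map (@loser A) o.1) (map (@loser A) o.2) ->
  forall v, (forall x, known (pos p' v) (pos q' v) x -> known (pos p v) (pos q v) x) /\
  deficit (pos p v) (pos q v) + ~~ known (pos p v) (pos q v) w <=
    deficit (pos p' v) (pos q' v).
Proof.
move=> ip iq rp rq so up uq pe v.
have se : size o.1 = size o.2 by rewrite -(size_map (@loser A)) (perm_size pe) size_map.
have pw := run_type_row so up rp.
have qw : pos q t w = #|A| by apply: run_type_row uq rq; rewrite -se.
have [pt rop] := run_uniform cardA ip rp up.
have [qt roq] := run_uniform cardA iq rq uq.
have [->|vt] := eqVneq v t.
  rewrite pt qt; split=> //.
  by rewrite /known pw qw eqxx agree_full ?addn0 //; [apply: ip.1|apply: iq.1].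
have {vt v} -> : v = ~~ t by case: v t vt {up uq pw qw pt rop qt roq} => -[].
have roq' : rotates (pos q (~~ t) w) (size o.1)
    (fun b => count_mem b (map (@loser A) o.1)) (pos q (~~ t)) (pos q' (~~ t)).
  case: roq => lo hi; split=> a; rewrite (permP pe) ?se; [exact: lo|exact: hi].
have ip' := irreducible_run cardA ip rp; have iq' := irreducible_run cardA iq rq.
have pn : pos p (~~ t) w < #|A|.
  have := irreducible_last cardA ip pw; have := position_range w (ip.1 (~~ t)).
  by case/andP=> _; rewrite leq_eqVlt => /orP[->|].
have qn : pos q (~~ t) w < #|A|.
  have := irreducible_last cardA iq qw; have := position_range w (iq.1 (~~ t)).
  by case/andP=> _; rewrite leq_eqVlt => /orP[->|].
have [kn de] := rotation_gain so pn qn (ip.1 _) (ip'.1 _) (iq.1 _) (iq'.1 _) rop roq'.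
split=> //; apply: leq_trans de; rewrite leq_add2l.
by case: (known (pos p' _) _ _) (kn w) => [->|_] //; case: known.
Qed.

Definition winners (L : seq (seq (rauzy_move A) * seq (rauzy_move A))) :=
  map (@winner A) (flatten (unzip1 L)).

(** A letter that is unknown at the beginning of the path is unknown throughout, so
    undoing a block that it wins lowers the deficit; and different letters win in
    different blocks. *)
Lemma path_gain (L : seq (seq (rauzy_move A) * seq (rauzy_move A))) p q p' q' v :
    irreducible p -> irreducible q -> all matched L ->
    run p (flatten (unzip1 L)) p' -> run q (flatten (unzip2 L)) q' ->
  deficit (pos p v) (pos q v) +
    #|[set x | ~~ known (pos p v) (pos q v) x & x \in winners L]| <=
    deficit (pos p' v) (pos q' v).
Proof.
elim: L p q => [|o L IH] p q ip iq /=.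
  move=> _ -> ->; rewrite -[X in _ <= X]addn0 leq_add2l leqn0 cards_eq0.
  by apply/eqP/setP => x; rewrite !inE andbF.
case/andP=> /matchedP[t [w [so up uq pe]]] cL /run_cat[p1 rp1 rp] /run_cat[q1 rq1 rq].
have ip1 := irreducible_run cardA ip rp1; have iq1 := irreducible_run cardA iq rq1.
have := IH _ _ ip1 iq1 cL rp rq; apply: leq_trans.
have [kn de] := block_gain ip iq rp1 rq1 so up uq pe v.
apply: leq_trans (leq_add de (leqnn _)); rewrite -addnA leq_add2l.
set K := known (pos p v) (pos q v).
have -> : nat_of_bool (~~ K w) = #|[set x | ~~ K x & x == w]|.
  case: (boolP (K w)) => Kw.
    apply/esym/eqP; rewrite cards_eq0; apply/eqP/setP => x; rewrite !inE.
    by apply/negbTE; rewrite negb_and; case: eqP => [->|]; rewrite ?Kw ?orbT.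
  rewrite /= -(cards1 w); apply: eq_card => x; rewrite !inE.
  by case: eqP => [->|]; rewrite ?Kw ?andbF.
apply: leq_trans (leq_of_leqif (leq_card_setU _ _)); apply: subset_leq_card.
apply/subsetP => x; rewrite !inE /winners /= map_cat mem_cat => /andP[Kx /orP[xo|xL]].
  rewrite Kx /=; apply/orP; left; move: xo; elim: (o.1) up => //= m s IHs.
  by case/andP=> /andP[_ /eqP->] /IHs{}IHs; rewrite inE => /orP[|/IHs].
by rewrite xL andbT; apply/orP; right; apply: contra Kx => /kn.
Qed.

(** A group wins with every letter, so the bound of [path_gain] counts all unknown
    letters, and [deficit_lt_unknown] doubles the deficit plus one. *)
Lemma complete_gain LL p q p' q' v :
    irreducible p -> irreducible q -> all (all matched) LL ->
    all (fun L => [forall x, x \in winners L]) LL ->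
    run p (flatten (unzip1 (flatten LL))) p' ->
    run q (flatten (unzip2 (flatten LL))) q' ->
  0 < deficit (pos p v) (pos q v) ->
  (deficit (pos p v) (pos q v)).+1 * 2 ^ size LL <= (deficit (pos p' v) (pos q' v)).+1.
Proof.
elim: LL p q => [|L LL IH] p q ip iq /=.
  by move=> _ _ -> -> _; rewrite muln1.
case/andP=> cL cLL /andP[wL wLL]; rewrite /unzip1 /unzip2 !map_cat !flatten_cat.
case/run_cat=> p1 rp1 rp /run_cat[q1 rq1 rq] D0.
have ip1 := irreducible_run cardA ip rp1; have iq1 := irreducible_run cardA iq rq1.
have := path_gain v ip iq cL rp1 rq1.
have -> : [set x | ~~ known (pos p v) (pos q v) x & x \in winners L] =
          [set x | ~~ known (pos p v) (pos q v) x].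
  by apply/setP => x; rewrite !inE (forallP wL) andbT.
have := deficit_lt_unknown (ip.1 v) (iq.1 v) D0 => DU DD.
have D1 : 0 < deficit (pos p1 v) (pos q1 v) by apply: leq_trans D0 _; lia.
have := IH _ _ ip1 iq1 cLL wLL rp rq D1; apply: leq_trans.
by rewrite expnS mulnA leq_mul2r; apply/orP; right; lia.
Qed.

Lemma determined LL s s' p q :
    irreducible p -> irreducible q -> all (all matched) LL ->
    all (fun L => [forall x, x \in winners L]) LL ->
    moves_from p (flatten (unzip1 (flatten LL)) ++ s) ->
    moves_from q (flatten (unzip2 (flatten LL)) ++ s') ->
    #|A| < 2 ^ (size LL).+1 ->
  p = q.
Proof.
move=> ip iq cLL wLL /moves_run[p2 /run_cat[p' rp _]] /moves_run[q2 /run_cat[q' rq _]] lt.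
have ip' := irreducible_run cardA ip rp; have iq' := irreducible_run cardA iq rq.
have row v : pos p v = pos q v.
  apply: deficit0_eq (ip.1 v) (iq.1 v) _; apply/eqP; rewrite -leqn0 leqNgt.
  apply/negP => D0; have := complete_gain ip iq cLL wLL rp rq D0.
  have := deficit_lt (ltnW cardA) (ip'.1 v) (iq'.1 v).
  have : 2 * 2 ^ size LL <= (deficit (pos p v) (pos q v)).+1 * 2 ^ size LL.
    by rewrite leq_mul2r ltnS D0 orbT.
  by move: lt; rewrite expnS; move: (_.+1 * _) => P; lia.
by move: (row false) (row true); case: p {ip rp row} => p0 p1;
  case: q {iq rq} => q0 q1 /= -> ->.
Qed.

End Gain.

(** * What the matrices determine *)

Section Decoding.
Local Open Scope nat_scope.
Variable A : finType.
Hypothesis cardA : 1 < #|A|.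
Implicit Types (p q : pos_pair A) (m : rauzy_move A) (s b : seq (rauzy_move A)).
Implicit Types (bs : seq (seq (rauzy_move A))).
Implicit Types (t : bool) (w : A).

Section Matrices.
Local Open Scope ring_scope.

(** Since the losers differ from [w], the elementary matrices do not interact and
    their off-diagonal parts add up. *)
Lemma theta_prodE w s (i j : 'I_#|A|) :
    all (fun m => winner m == w) s -> all (fun m => loser m != w) s ->
  (\prod_(m <- s) theta m) i j =
  (i == j)%:R + ((i == enum_rank w) * count_mem (enum_val j) (map (@loser A) s))%:R.
Proof.
elim: s i j => [|m s IH] i j /=; first by rewrite big_nil muln0 addr0 mxE.
case/andP=> /eqP mw sw /andP[ml sl]; rewrite big_cons.
rewrite -[_ * _]/(_ *m _) mxE.
have thetaE k : theta m i k = (i == k)%:R +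
    ((i == enum_rank w) && (k == enum_rank (loser m)))%:R.
  rewrite mxE mw; have [->|] /= := eqVneq i k; last by rewrite mulr0n add0r.
  have [kw|_] /= := eqVneq k (enum_rank w); last by rewrite mulr0n addr0.
  by rewrite kw (inj_eq enum_rank_inj) eq_sym (negPf ml) mulr0n addr0.
set M := \prod_(m <- s) theta m.
transitivity (\sum_k ((i == k)%:R * M k j +
    ((i == enum_rank w) && (k == enum_rank (loser m)))%:R * M k j)).
  by apply: eq_bigr => k _; rewrite -mulrDl; congr (_ * _); apply: thetaE.
rewrite big_split /= (bigD1 i) //= eqxx mul1r big1 ?addr0; last first.
  by move=> k /negPf; rewrite eq_sym => ->; rewrite mul0r.
rewrite (bigD1 (enum_rank (loser m))) //= eqxx andbT [X in _ + (_ + X)]big1 ?addr0.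
  rewrite !IH // (inj_eq enum_rank_inj) (negPf ml) mul0n mulr0n addr0 -addrA; congr (_ + _).
  rewrite -natrM -natrD mulnDr addnC; congr ((_ * _) + _)%:R.
  by rewrite -(inj_eq enum_rank_inj) enum_valK.
by move=> k /negPf ->; rewrite andbF mul0r.
Qed.

Lemma theta_prod_losses w w' s s' :
    (0 < size s)%N ->
    all (fun m => winner m == w) s -> all (fun m => loser m != w) s ->
    all (fun m => winner m == w') s' -> all (fun m => loser m != w') s' ->
    \prod_(m <- s) theta m = \prod_(m <- s') theta m ->
  w = w' /\ perm_eq (map (@loser A) s) (map (@loser A) s').
Proof.
move=> s0 sw sl sw' sl' e.
have E a : (count_mem a (map (@loser A) s) =
            (w == w') * count_mem a (map (@loser A) s'))%N.
  have := theta_prodE (enum_rank w) (enum_rank a) sw sl.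
  rewrite e (theta_prodE _ _ sw' sl') enum_rankK eqxx mul1n => /addrI/eqP.
  by rewrite eqr_nat (inj_eq enum_rank_inj) => /eqP.
have ww : w = w'.
  case: s s0 E {sw sl e} => // m s _ /(_ (loser m)) /=; rewrite eqxx.
  by case: eqP.
by split=> //; apply/allP => a _; rewrite /= E ww eqxx mul1n.
Qed.
End Matrices.

Lemma run_losers p s p' w : irreducible p -> run p s p' ->
  all (fun m => winner m == w) s -> all (fun m => loser m != w) s.
Proof.
elim: s p => //= m s IH p ip [p1 st r] /andP[/eqP mw sw].
by rewrite (IH _ (irreducible_step cardA ip st) r sw) andbT -mw eq_sym
  (winner_neq_loser cardA ip st).
Qed.

Lemma run_same_type p s p' : irreducible p -> run p s p' ->
  0 < size s -> same_type s -> exists w, all (fun m => winner m == w) s.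
Proof.
move=> ip /(run_sorted cardA ip); case: s => //= m s; elim: s m => [|m' s IH] m.
  by exists (winner m); rewrite /= eqxx.
move=> /= /andP[fol pa] _ /existsP[t /and3P[/eqP mt /eqP mt' st]].
have [|w /= /andP[/eqP w' sw]] := IH m' pa isT.
  by apply/existsP; exists t; rewrite /= mt' eqxx.
exists w; rewrite w' eqxx sw; move: fol; rewrite /follows mt mt' eqxx w'.
by move=> /eqP ->; rewrite eqxx.
Qed.

(** What the matrices give directly; the types, which complete it to [matched], need
    the whole path. *)
Definition same_losses (o : seq (rauzy_move A) * seq (rauzy_move A)) :=
  [exists w, [&& 0 < size o.1, all (fun m => winner m == w) o.1,
    all (fun m => winner m == w) o.2 &
    perm_eq (map (@loser A) o.1) (map (@loser A) o.2)]].

Lemma decode_blocks bs bs' p q :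
    irreducible p -> irreducible q ->
    moves_from p (flatten bs) -> moves_from q (flatten bs') ->
    all (fun b => (0 < size b) && same_type b) bs ->
    all (fun b => (0 < size b) && same_type b) bs' ->
    [seq \prod_(m <- b) theta m | b <- bs]%R = [seq \prod_(m <- b) theta m | b <- bs']%R ->
  all same_losses (zip bs bs').
Proof.
move=> ip iq /moves_run[p' rp] /moves_run[q' rq].
elim: bs bs' p q ip iq rp rq => [|b bs IH] [|b' bs'] p q ip iq //=.
move=> /run_cat[p1 rp1 rp] /run_cat[q1 rq1 rq].
case/andP=> /andP[b0 bt] vb /andP[/andP[b0' bt'] vb'] [e1 e2].
rewrite (IH _ _ _ (irreducible_run cardA ip rp1) (irreducible_run cardA iq rq1) rp rq) //.
have [w bw] := run_same_type ip rp1 b0 bt.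
have [w' bw'] := run_same_type iq rq1 b0' bt'.
have [e pe] := theta_prod_losses b0 bw (run_losers ip rp1 bw) bw' (run_losers iq rq1 bw') e1.
by rewrite andbT; apply/existsP; exists w; rewrite b0 bw pe /= e bw'.
Qed.

Lemma same_losses_size o : same_losses o -> size o.1 = size o.2.
Proof. by case/existsP=> w /and4P[_ _ _ /perm_size]; rewrite !size_map. Qed.

Lemma same_losses_winners bs bs' : size bs = size bs' ->
  all same_losses (zip bs bs') ->
  map (@winner A) (flatten bs) = map (@winner A) (flatten bs').
Proof.
elim: bs bs' => [|b bs IH] [|b' bs'] //= [sz] /andP[bb bbs].
rewrite !map_cat (IH bs') //; congr (_ ++ _).
have := same_losses_size bb; case/existsP: bb => w /= /and4P[_ bw bw' _].
elim: b b' bw bw' => [|m b IHb] [|m' b'] //= /andP[/eqP-> bw] /andP[/eqP-> bw'] [s].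
by rewrite (IHb b').
Qed.

(** The type changes exactly when the winner does, so the first type fixes the
    others. *)
Lemma follows_type s s' : sorted (@follows A) s -> sorted (@follows A) s' ->
    map (@winner A) s = map (@winner A) s' ->
    ohead (map (@move_type A) s) = ohead (map (@move_type A) s') ->
  map (@move_type A) s = map (@move_type A) s'.
Proof.
case: s => [|m s]; case: s' => [|m' s'] //= ps ps' [w ws] [t]; rewrite t; congr cons.
elim: s s' m m' ps ps' w ws t => [|n s IH] [|n' s'] //= m m'.
case/andP=> f ps /andP[f' ps'] w [wn ws] t.
have tn : move_type n = move_type n'.
  move: f f'; rewrite /follows t w wn.
  have [->|h] := eqVneq (move_type n) (move_type m').
    by move/eqP=> ->; case: (eqVneq (move_type n') _) => // _; rewrite eqxx andbF.
  case/andP=> _ nw; case: (eqVneq (move_type n') _) => [_|h'].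
    by move=> e; rewrite e in nw.
  by move=> _; move: h h'; case: (move_type n); case: (move_type n'); case: (move_type m').
by rewrite tn (IH s' n n').
Qed.

Lemma matched_blocks bs bs' : size bs = size bs' ->
    all same_losses (zip bs bs') -> all (@same_type A) bs ->
    map (@move_type A) (flatten bs) = map (@move_type A) (flatten bs') ->
  all (@matched A) (zip bs bs').
Proof.
elim: bs bs' => [|b bs IH] [|b' bs'] //= [sz] /andP[bb bbs] /andP[bt bst].
rewrite !map_cat => /eqP; rewrite eqseq_cat ?size_map ?(same_losses_size bb) //.
case/andP=> /eqP tb /eqP tbs; rewrite (IH bs') // andbT.
case/existsP: bb => w /= /and4P[b0 bw bw' pe]; case/existsP: bt => t bt.
apply/matchedP; exists t, w; split=> //; rewrite /uniform.
  by rewrite (all_predI (fun m => move_type m == t) (fun m => winner m == w)) bt.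
rewrite (all_predI (fun m => move_type m == t) (fun m => winner m == w)) bw' andbT.
by rewrite -(all_map (@move_type A) (eq_op^~ t)) -tb all_map.
Qed.

(** * Aligning blocks with complete paths *)

Notation obs := (seq (rauzy_move A) * seq (rauzy_move A))%type.

Lemma cut_blocks (L : seq obs) k : k <= size (flatten (unzip1 L)) ->
  exists La Lb, L = La ++ Lb /\
  (size (flatten (unzip1 La)) = k \/
   exists o Lc, Lb = o :: Lc /\
     size (flatten (unzip1 La)) < k < size (flatten (unzip1 La)) + size o.1).
Proof.
elim: L k => [|o L IH] k /=.
  by rewrite leqn0 => /eqP->; exists [::], [::]; split=> //; left.
rewrite size_cat => kL.
case: (posnP k) => [->|k0]; first by exists [::], (o :: L); split=> //; left.
have [ko|ko] := ltnP k (size o.1).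
  exists [::], (o :: L); split=> //; right; exists o, L; split=> //=.
  by rewrite k0.
have [|La [Lb [-> H]]] := IH (k - size o.1); first by lia.
exists (o :: La), Lb; split=> //=; rewrite size_cat.
case: H => [H|[o' [Lc [-> H]]]]; [left; lia|right].
by exists o', Lc; split=> //; lia.
Qed.

(** The complete word [pc] of winners may end inside a block.  If the winner [w] of
    this block has won before, the whole block is left to [L'].  Otherwise its
    first move goes to [G] and the others to [L'], which is possible because both
    first losers are the winner [wc] of the preceding block. *)
Lemma split_group (L : seq obs) (pc rest : seq A) :
    all (@matched A) L ->
    sorted (@follows A) (flatten (unzip1 L)) ->
    sorted (@follows A) (flatten (unzip2 L)) ->
    winners L = pc ++ rest -> (forall x, x \in pc) ->
  exists G L' y, [/\ all (@matched A) G && all (@matched A) L',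
    flatten (unzip1 L) = flatten (unzip1 (G ++ L')),
    flatten (unzip2 L) = flatten (unzip2 (G ++ L')),
    forall x, x \in winners G
    & winners L' = y ++ rest].
Proof.
move=> cL s1 s2 wL cpc.
have [|La [Lb [eL H]]] := @cut_blocks L (size pc).
  by rewrite -(size_map (@winner A)) -/(winners L) wL size_cat leq_addr.
subst L; move: cL; rewrite all_cat => /andP[cLa cLb].
have wLL : winners La ++ winners Lb = pc ++ rest.
  by rewrite -wL /winners /unzip1 map_cat flatten_cat map_cat.
case: H => [H|[o [Lc [eLb /andP[ko ok]]]]].
  exists La, Lb, [::]; split=> //; first by rewrite cLa.
    move: wLL => /eqP; rewrite eqseq_cat ?size_map // => /andP[/eqP -> _].
    exact: cpc.
  by move: wLL => /eqP; rewrite eqseq_cat ?size_map // => /andP[_ /eqP ->].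
subst Lb; move: cLb => /= /andP[co cLc].
have /matchedP[t [w [o0 u1 u2 pe]]] := co.
have wo : winners (o :: Lc) = nseq (size o.1) w ++ winners Lc.
  rewrite /winners /= map_cat; congr (_ ++ _).
  by elim: (o.1) u1 => //= m s IHs /andP[/andP[_ /eqP ->] /IHs ->].
have sLa : size (winners La) = size (flatten (unzip1 La)) by rewrite size_map.
have pcE : pc = winners La ++ nseq (size pc - size (winners La)) w.
  have := congr1 (take (size pc)) wLL.
  rewrite [RHS]take_size_cat // wo take_cat ltnNge sLa (ltnW ko) /= => e.
  rewrite -{1}e; congr (_ ++ _).
  by rewrite take_cat size_nseq ltn_subLR ?(ltnW ko) // ok take_nseq //; move: ok; lia.
have [j restE] : exists j, winners (o :: Lc) = nseq j.+1 w ++ rest.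
  exists (size pc - size (winners La)).-1; rewrite prednK; last first.
    by rewrite subn_gt0 sLa.
  by move: wLL; rewrite {1}pcE -catA => /eqP; rewrite eqseq_cat // eqxx /= => /eqP.
have inLa x : x != w -> x \in winners La.
  move=> xw; have := cpc x; rewrite pcE mem_cat => /orP[//|].
  by rewrite mem_nseq (negPf xw) andbF.
have [wLa|wLa] := boolP (w \in winners La).
  exists La, (o :: Lc), (nseq j.+1 w); split=> //=.
    by rewrite cLa co.
  by move=> x; have [->|/inLa] := eqVneq x w.
(* [La] is nonempty: a complete word has a letter other than [w]. *)
case: (lastP La) inLa wLa cLa sLa ko ok pcE s1 s2 wLL wL => [|La' oc].
  move=> inLa _ _ _ _ _ _ _ _ _ _.
  suff : #|A| <= 1 by rewrite leqNgt cardA.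
  rewrite -(cards1 w); apply/subset_leq_card/subsetP => x _; rewrite inE.
  by apply: contraT => /inLa.
move=> inLa wLa cLa sLa ko ok pcE s1 s2 wLL wL.
move: (cLa); rewrite all_rcons => /andP[/matchedP[tc [wc [oc0 uc1 uc2 pec]]] _].
have so : size o.1 = size o.2.
  by rewrite -(size_map (@loser A)) (perm_size pe) size_map.
have soc : size oc.1 = size oc.2.
  by rewrite -(size_map (@loser A)) (perm_size pec) size_map.
(* The winners differ, so the type changes between the two blocks and the winner
   of the first one is last in the row that the second one rotates. *)
have first_loser c b : sorted (@follows A) (c ++ b) -> 0 < size c ->
    uniform tc wc c -> uniform t w b -> wc != w ->
  forall m b', b = m :: b' -> loser m = wc.
  move=> so' c0 uc ub wcw m b' eb; subst b.
  case: (lastP c) so' c0 uc => // c' l + _.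
  rewrite -cats1 -catA /= => /cat_sorted2[_ /= /andP[fol _]].
  rewrite /uniform all_cat /= => /andP[_ /andP[/andP[_ /eqP lw] _]].
  case/andP: ub => /andP[_ /eqP mw] _.
  move: fol; rewrite /follows lw mw; case: eqP => _.
    by rewrite eq_sym (negPf wcw).
  by case/andP=> /eqP.
have wcw : wc != w.
  apply: contra wLa => /eqP <-; rewrite /winners /unzip1 map_rcons -cats1.
  rewrite flatten_cat map_cat mem_cat /= cats0; apply/orP; right.
  by case: (oc.1) oc0 uc1 => //= m s _ /andP[/andP[_ /eqP ->] _]; rewrite inE eqxx.
have fl1 : flatten (unzip1 (rcons La' oc ++ o :: Lc)) =
    flatten (unzip1 La') ++ (oc.1 ++ o.1) ++ flatten (unzip1 Lc).
  by rewrite /unzip1 map_cat map_rcons -cats1 !flatten_cat /= cats0 -!catA.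
have fl2 : flatten (unzip2 (rcons La' oc ++ o :: Lc)) =
    flatten (unzip2 La') ++ (oc.2 ++ o.2) ++ flatten (unzip2 Lc).
  by rewrite /unzip2 map_cat map_rcons -cats1 !flatten_cat /= cats0 -!catA.
have sub1 : sorted (@follows A) (oc.1 ++ o.1).
  by move: s1; rewrite fl1 => /cat_sorted2[_ /cat_sorted2[]].
have sub2 : sorted (@follows A) (oc.2 ++ o.2).
  by move: s2; rewrite fl2 => /cat_sorted2[_ /cat_sorted2[]].
have l1 := first_loser _ _ sub1 oc0 uc1 u1 wcw.
have l2 := first_loser _ _ sub2; rewrite -soc in l2; have {}l2 := l2 oc0 uc2 u2 wcw.
have o2 : 1 < size o.1 by move: ko ok; clear; lia.
case: o so {co ko ok wo fl1 fl2 sub1 sub2 s1 s2 wLL wL} o0 o2 u1 u2 pe l1 l2 restE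
  => [[|m1 b1] [|m2 b2]] //= _ _ o2 /andP[um1 ub1] /andP[um2 ub2] pe l1 l2 [_ restE].
rewrite (l1 _ _ (erefl _)) (l2 _ _ (erefl _)) perm_cons in pe.
exists (rcons (rcons La' oc) ([:: m1], [:: m2])), ((b1, b2) :: Lc), (nseq j w).
split=> //.
- rewrite all_rcons cLa /= cLc !andbT; apply/andP; split; apply/matchedP; exists t, w.
    split=> //=; rewrite ?um1 ?um2 //.
    by rewrite (l1 _ _ (erefl _)) (l2 _ _ (erefl _)).
  by split.
- by rewrite /unzip1 !map_cat !map_rcons -!cats1 !flatten_cat /= -!catA.
- by rewrite /unzip2 !map_cat !map_rcons -!cats1 !flatten_cat /= -!catA.
move=> x; rewrite /winners /unzip1 map_rcons -cats1 flatten_cat map_cat mem_cat.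
have [->|/inLa] := eqVneq x w; last by rewrite /winners /unzip1 => ->.
by case/andP: um1 => _ /eqP mw; rewrite /= inE mw eqxx orbT.
Qed.

(** The word [y] stands for the moves handed over by a preceding group; they only
    add winners to the next one. *)
Lemma regroup (words : seq (seq A)) (L : seq obs) (y rest : seq A) :
    all (@matched A) L ->
    sorted (@follows A) (flatten (unzip1 L)) ->
    sorted (@follows A) (flatten (unzip2 L)) ->
    winners L = y ++ flatten words ++ rest ->
    (forall u, u \in words -> forall x, x \in u) ->
  exists LL L', [/\ size LL = size words,
    all (all (@matched A)) LL,
    all (fun G => [forall x, x \in winners G]) LL,
    flatten (unzip1 L) = flatten (unzip1 (flatten LL)) ++ flatten (unzip1 L') &
    flatten (unzip2 L) = flatten (unzip2 (flatten LL)) ++ flatten (unzip2 L')].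
Proof.
elim: words L y => [|u words IH] L y cL s1 s2 wL cw.
  by exists [::], L.
have cu x : x \in y ++ u by rewrite mem_cat (cw u) ?orbT // inE eqxx.
rewrite /= -catA catA in wL.
have [G [L1 [y1 [/andP[cG cL1] e1 e2 cGx wL1]]]] := split_group cL s1 s2 wL cu.
have E1 : flatten (unzip1 L) = flatten (unzip1 G) ++ flatten (unzip1 L1).
  by rewrite e1 /unzip1 map_cat flatten_cat.
have E2 : flatten (unzip2 L) = flatten (unzip2 G) ++ flatten (unzip2 L1).
  by rewrite e2 /unzip2 map_cat flatten_cat.
have [||v vw|LL [L' [sz cLL wLL f1 f2]]] := IH L1 y1 cL1 _ _ wL1.
- by move: s1; rewrite E1 => /cat_sorted2[].
- by move: s2; rewrite E2 => /cat_sorted2[].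
- by apply: cw; rewrite inE vw orbT.
exists (G :: LL), L'; split=> /=; rewrite ?sz ?cG //.
- by rewrite wLL andbT; apply/forallP.
- by rewrite E1 f1 catA /unzip1 map_cat flatten_cat.
- by rewrite E2 f2 catA /unzip2 map_cat flatten_cat.
Qed.

(** The complete pieces of the path enter only through their words of winners,
    because they need not be unions of blocks. *)
Lemma same_first_type bs bs' p q (words : seq (seq A)) :
    irreducible p -> irreducible q ->
    moves_from p (flatten bs) -> moves_from q (flatten bs') ->
    all (fun b => (0 < size b) && same_type b) bs ->
    all (fun b => (0 < size b) && same_type b) bs' ->
    [seq \prod_(m <- b) theta m | b <- bs]%R = [seq \prod_(m <- b) theta m | b <- bs']%R ->
    ohead (map (@move_type A) (flatten bs)) = ohead (map (@move_type A) (flatten bs')) ->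
    map (@winner A) (flatten bs) = flatten words ->
    (forall u, u \in words -> forall x, x \in u) ->
    #|A| < 2 ^ (size words).+1 ->
  p = q.
Proof.
move=> ip iq rp rq vb vb' e th wb cw lt.
have sz : size bs = size bs'.
  by rewrite -(size_map (fun b => \prod_(m <- b) theta m)%R) e size_map.
have sl := decode_blocks ip iq rp rq vb vb' e.
have [p' rp'] := moves_run rp; have [q' rq'] := moves_run rq.
have s1 := run_sorted cardA ip rp'; have s2 := run_sorted cardA iq rq'.
have ty := follows_type s1 s2 (same_losses_winners sz sl) th.
have cL : all (@matched A) (zip bs bs').
  apply: matched_blocks sz sl _ ty.
  by apply: sub_all vb => b /andP[].
have z1 : unzip1 (zip bs bs') = bs by rewrite unzip1_zip ?sz.
have z2 : unzip2 (zip bs bs') = bs' by rewrite unzip2_zip ?sz.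
rewrite -z1 in s1 rp; rewrite -z2 in s2 rq.
have wL : winners (zip bs bs') = [::] ++ flatten words ++ [::] by rewrite /winners z1 cats0.
have [LL [L' [sLL cLL wLL f1 f2]]] := regroup cL s1 s2 wL cw.
rewrite f1 in rp; rewrite f2 in rq.
by apply: (determined cardA ip iq cLL wLL rp rq); rewrite sLL.
Qed.

(** * Inversion, and the theorem *)

Definition flip m := RauzyMove (~~ move_type m) (winner m) (loser m).

Lemma flip_irreducible p : irreducible p -> irreducible (inverse_pair p).
Proof.
case=> ip neq; split; first by case; [exact: (ip false) | exact: (ip true)].
by move=> k /neq; rewrite eq_sym.
Qed.

Lemma flip_moves p s : moves_from p s -> moves_from (inverse_pair p) (map flip s).
Proof.
have inv r t : pos (inverse_pair r) t = pos r (~~ t) by case: t.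
elim: s p => //= m s IH p [p1 [pw pl pt pu] /IH r]; exists (inverse_pair p1) => //.
by split=> /=; rewrite ?inv ?negbK // => b; rewrite ?inv ?negbK pu.
Qed.
End Decoding.

Lemma log2_bound (R : realType) (n C : nat) :
  log2 ((n + 1)%:R : R) - 1 <= C%:R -> (n < 2 ^ C.+1)%N.
Proof.
rewrite /log2 lerBlDr ler_pdivrMr ?ln_gt0 ?ltr1n // => H.
have : (ln ((n + 1)%:R : R) <= ln ((2 ^ C.+1)%:R : R))%R.
  by rewrite natrX lnXn ?ltr0n // -[X in (_ <= X)%R]mulr_natl -natr1.
by rewrite ler_ln ?posrE ?ltr0n ?expn_gt0 ?addn1 // ler_nat.
Qed.

Theorem theorem3p7 (R : realType) (A : finType) (C : nat)
    (Ts : seq 'M[int]_#|A|)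
    (cardA : (2 <= #|A|)%N)
    (hC : log2 ((#|A| + 1)%:R : R) - 1 <= C%:R)
    (zTs : zorich_path Ts)
    (cTs : C_complete_zorich C Ts) :
  forall p q : pos_pair A,
    irreducible p -> irreducible q ->
    initial_pair Ts p -> initial_pair Ts q ->
    q = p \/ q = inverse_pair p.
Proof.
move=> p q ip iq [s [[_ mp] [bs [es vb eb]]]] [s' [[_ mq] [bs' [es' vb' eb']]]].
subst s s'.
have lt := log2_bound hC.
case: cTs => r [s [[[ir mr] [br [sr vr er]]] [ss [sC css es]]]]; subst s.
(* Completeness only depends on the winners, which every underlying path shares;
   so the complete decomposition of the path from [r] serves for the one from [p]. *)
have wb : map (@winner A) (flatten bs) = flatten (map (map (@winner A)) ss).
  rewrite -map_flatten -es; apply: same_losses_winners.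
    by rewrite -(size_map (fun b => \prod_(m <- b) theta m)) -eb er size_map.
  by apply: (decode_blocks cardA ip ir mp mr vb vr); rewrite -eb -er.
have cw (u : seq A) : u \in map (map (@winner A)) ss -> forall x, x \in u.
  elim: ss css {sC es wb} => //= s ss IH /andP[cs css].
  by rewrite inE => /orP[/eqP->|us] x; [exact: (forallP cs) | exact: IH].
have lt' : (#|A| < 2 ^ (size (map (map (@winner A)) ss)).+1)%N by rewrite size_map sC.
have e : [seq \prod_(m <- b) theta m | b <- bs] = [seq \prod_(m <- b) theta m | b <- bs'].
  by rewrite -eb.
(* If the first types differ, inverting [q] exchanges all types of its path. *)
have [th|th] := eqVneq (ohead (map (@move_type A) (flatten bs)))
                      (ohead (map (@move_type A) (flatten bs'))).
  by left; rewrite (same_first_type cardA ip iq mp mq vb vb' e th wb cw lt').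
right; suff -> : p = inverse_pair q by case: q {iq mq}.
apply: (same_first_type cardA ip (flip_irreducible iq) mp _ vb _ _ _ wb cw lt'
  (bs' := map (map (@flip A)) bs')).
- by rewrite -map_flatten; apply: flip_moves.
- rewrite all_map; apply: sub_all vb' => b /andP[b0 /existsP[t bt]] /=.
  rewrite size_map b0; apply/existsP; exists (~~ t); rewrite all_map.
  by apply: sub_all bt => m /= /eqP ->.
- by rewrite e -map_comp; apply: eq_map => b /=; rewrite big_map.
rewrite -map_flatten; have sz : size (flatten bs) = size (flatten bs').
  rewrite -(size_map (@winner A)) (same_losses_winners (bs' := bs')) ?size_map //.
    by rewrite -(size_map (fun b => \prod_(m <- b) theta m)) e size_map.
  exact: (decode_blocks cardA ip iq mp mq vb vb' e).
case: (flatten bs) (flatten bs') sz th => [|m s] [|m' s'] //= _.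
by case: (move_type m); case: (move_type m').
Qed.
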